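(* Let $f(z)=\sum_{n=0}^\infty a_nz^n$ be an analytic function in $\mathbb{D}$ with $|f(z)|\le 1$ for all $z\in\mathbb{D}$. Then $$\frac{1-(1+|a_0|-|a_0|^2)r}{1-|a_0|r}+\sum_{n=1}^\infty |a_n|r^n\le 1\quad\text{for all } 0\le r\le\frac13 .$$ The inequality is sharp: for every $a_0\in\mathbb{D}$ and every $0\le r\le \frac13$, equality holds for the function $\frac{z+a_0}{1+\overline{a_0}z}$.
   Context: $\mathbb{D}=\{z\in\mathbb{C}:|z|<1\}$. *)

(* Defs.v *)
From Stdlib Require Import Reals.
From Coquelicot Require Import Coquelicot.
Open Scope R_scope.

Definition in_disc (z : C) : Prop := Cmod z < 1.

(* f is analytic in the unit disc with f(z) = sum_n a_n z^n there.  The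
   implicit structures are pinned so that the series converges in C, as a
   normed module over itself.  The values of f outside the disc are
   irrelevant. *)
Definition analytic_in_disc_with_coeffs (f : C -> C) (a : nat -> C) : Prop :=
  forall z : C, in_disc z ->
    @is_pseries C_AbsRing C_NormedModule a z (f z).

Definition bounded_by_one_in_disc (f : C -> C) : Prop :=
  forall z : C, in_disc z -> Cmod (f z) <= 1.

(* [Series] is a total function, so this is meaningful only together with
   the convergence of [majorant_tail a r]. *)
Definition majorant_tail (a : nat -> C) (r : R) (n : nat) : R :=
  Cmod (a (S n)) * r ^ (S n).

Definition refined_bohr_sum (a : nat -> C) (r : R) : R :=
  (1 - (1 + Cmod (a O) - Cmod (a O) ^ 2) * r) / (1 - Cmod (a O) * r)
  + Series (majorant_tail a r).

Definition mobius (a0 : C) (z : C) : C :=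
  ((z + a0) / (1 + Cconj a0 * z))%C.

(* Main.v *)
(** By Parseval, multiplication by [f] contracts the Hardy norm, so the lower
    triangular Toeplitz matrices of [a] have norm at most 1.  This property
    passes algebraically to the coefficients of [h], where
    [z h = (f - a_0) / (1 - conj a_0 f)], so no analyticity or boundedness of
    [h] as a function is needed.  A 2x2 submatrix yields
    [|h_n| <= 1 - |h_0|^2], whence Bohr's inequality [M h <= 1] for the
    majorant [M h = sum |h_n| r^n] at [r <= 1/3].  Submultiplicativity of [M]
    applied to [f - a_0 = z h ((1 - |a_0|^2) - conj a_0 (f - a_0))] then gives
    [M (f - a_0) <= r (1 - |a_0|^2 + |a_0| M (f - a_0))], which is the claim. *)

Require Import Defs.
From Stdlib Require Import Reals Lra Lia.
From Coquelicot Require Import Coquelicot.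
Open Scope R_scope.

(** * Cauchy products of coefficient sequences *)

Definition shift (a : nat -> C) : nat -> C := fun n => a (S n).

(* Cauchy product, by recursion on the head of [a] so that
   [shift (conv a b)] unfolds to [a_0 shift b + conv (shift a) b]. *)
Fixpoint conv (a b : nat -> C) (n : nat) : C :=
  match n with
  | O => (a O * b O)%C
  | S m => (a O * b (S m) + conv (shift a) b m)%C
  end.

(** Squared Hardy norm of the polynomial cut off after degree [n], as [parseval] makes precise. *)
Definition energy (a : nat -> C) (n : nat) : R :=
  sum_f_R0 (fun k => Cmod (a k) ^ 2) n.

Definition majorant (a : nat -> C) (r : R) (n : nat) : R :=
  sum_f_R0 (fun k => Cmod (a k) * r ^ k) n.

(* The (n+1)x(n+1) lower triangular Toeplitz matrix of [a] has operator norm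
   at most 1. *)
Definition contractive (a : nat -> C) (n : nat) : Prop :=
  forall x : nat -> C, energy (conv a x) n <= energy x n.

Lemma conv_ext (a a' b b' : nat -> C) (n : nat) :
  (forall k, (k <= n)%nat -> a k = a' k) ->
  (forall k, (k <= n)%nat -> b k = b' k) ->
  conv a b n = conv a' b' n.
Proof.
  revert a a'; induction n as [|n IH]; intros a a' Ha Hb; simpl.
  - now rewrite Ha, Hb by lia.
  - rewrite Ha, Hb by lia. f_equal. apply IH.
    + intros k Hk; apply Ha; lia.
    + intros k Hk; apply Hb; lia.
Qed.

(** Mirror image of the defining recursion, peeling the head of the right factor instead;
    commutativity comes from playing the two recursions against each other. *)
Lemma conv_S_r (a b : nat -> C) (n : nat) :
  conv a b (S n) = (conv a (shift b) n + a (S n) * b O)%C.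
Proof.
  revert a; induction n as [|n IH]; intros a.
  - reflexivity.
  - change (conv a b (S (S n)))
      with (a O * b (S (S n)) + conv (shift a) b (S n))%C.
    rewrite IH.
    change (conv a (shift b) (S n))
      with (a O * b (S (S n)) + conv (shift a) (shift b) n)%C.
    unfold shift. ring.
Qed.

Lemma conv_comm (a b : nat -> C) (n : nat) : conv a b n = conv b a n.
Proof.
  revert a; induction n as [|n IH]; intros a.
  - simpl; ring.
  - rewrite (conv_S_r b a), <- (IH (shift a)). simpl. ring.
Qed.

Lemma conv_plus_l (a b x : nat -> C) (n : nat) :
  conv (fun k => a k + b k)%C x n = (conv a x n + conv b x n)%C.
Proof.
  revert a b; induction n as [|n IH]; intros a b; simpl.
  - ring.
  - unfold shift at 1. rewrite IH. unfold shift. ring.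
Qed.

Lemma conv_scal_l (c : C) (a x : nat -> C) (n : nat) :
  conv (fun k => c * a k)%C x n = (c * conv a x n)%C.
Proof.
  revert a; induction n as [|n IH]; intros a; simpl.
  - ring.
  - unfold shift at 1. rewrite IH. unfold shift. ring.
Qed.

Lemma conv_0_l (a x : nat -> C) (n : nat) :
  (forall k, a k = 0) -> conv a x n = 0.
Proof.
  intros H.
  rewrite (conv_ext a (fun k => 0 * a k)%C x x n), conv_scal_l; trivial.
  - ring.
  - intros k _. rewrite H. ring.
Qed.

Lemma conv_assoc (a b c : nat -> C) (n : nat) :
  conv (conv a b) c n = conv a (conv b c) n.
Proof.
  revert a; induction n as [|n IH]; intros a.
  - simpl; ring.
  - change (conv (conv a b) c (S n)) with
      (a O * b O * c (S n)
       + conv (fun k => a O * shift b k + conv (shift a) b k)%C c n)%C.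
    rewrite conv_plus_l, conv_scal_l, IH; simpl. ring.
Qed.

(** The left factor is the coefficient sequence of c + d f, the indicator carrying the constant
    term. Both f - a_0 and 1 - conj a_0 f have this form. *)
Lemma conv_affine_l (c d : C) (a x : nat -> C) (n : nat) :
  conv (fun k => (if Nat.eqb k 0 then c else 0) + d * a k)%C x n
  = (c * x n + d * conv a x n)%C.
Proof.
  rewrite conv_plus_l, conv_scal_l. f_equal.
  destruct n as [|n]; [reflexivity|].
  simpl. rewrite conv_0_l by reflexivity. ring.
Qed.

(** The dilation z -> c z is multiplicative on power series. *)
Lemma conv_pow (c : C) (a b : nat -> C) (n : nat) :
  conv (fun k => a k * c ^ k)%C (fun k => b k * c ^ k)%C n
  = (conv a b n * c ^ n)%C.
Proof.
  revert a; induction n as [|n IH]; intros a.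
  - simpl; ring.
  - simpl conv.
    rewrite (conv_ext _ (fun k => c * (shift a k * c ^ k))%C
      (fun k => b k * c ^ k)%C (fun k => b k * c ^ k)%C).
    + rewrite conv_scal_l, IH. simpl. ring.
    + intros k _. unfold shift. simpl. ring.
    + reflexivity.
Qed.

(** Forward substitution in a lower triangular Toeplitz system with diagonal entry [u O]. This is
    division of power series, carried out only up to degree [n]. *)
Lemma conv_solve (u y : nat -> C) (n : nat) :
  u O <> 0 ->
  exists x, forall k, (k <= n)%nat -> conv u x k = y k.
Proof.
  intros Hu. induction n as [|n [x IH]].
  - exists (fun _ => y O / u O)%C. intros k Hk.
    replace k with O by lia. simpl. field. exact Hu.
  (* The value forced on the next unknown once the earlier ones are fixed. *)
  - set (v := ((y (S n) - conv (shift u) x n) / u O)%C).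
    exists (fun k => if Nat.eqb k (S n) then v else x k).
    assert (Hx : forall k, (k <= n)%nat ->
        (if Nat.eqb k (S n) then v else x k) = x k).
    { intros k Hk. destruct (Nat.eqb_spec k (S n)); [lia|reflexivity]. }
    intros k Hk. destruct (Nat.eq_dec k (S n)) as [->|Hne].
    + simpl conv at 1. rewrite Nat.eqb_refl.
      rewrite (conv_ext (shift u) (shift u) _ x n) by auto.
      unfold v. field. exact Hu.
    + rewrite (conv_ext u u _ x k); auto.
      * apply IH; lia.
      * intros j Hj. apply Hx; lia.
Qed.

(** * Energies and majorants of finite sections *)

Lemma sum_f_R0_S_l (f : nat -> R) (n : nat) :
  sum_f_R0 f (S n) = f O + sum_f_R0 (fun k => f (S k)) n.
Proof. apply decomp_sum; lia. Qed.

Lemma energy_S_l (a : nat -> C) (n : nat) :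
  energy a (S n) = Cmod (a O) ^ 2 + energy (shift a) n.
Proof. apply sum_f_R0_S_l. Qed.

Lemma energy_ext (a b : nat -> C) (n : nat) :
  (forall k, (k <= n)%nat -> a k = b k) -> energy a n = energy b n.
Proof.
  intros H. apply sum_eq. intros k Hk. now rewrite H.
Qed.

Lemma energy_pos (a : nat -> C) (n : nat) : 0 <= energy a n.
Proof. apply cond_pos_sum. intros k. apply pow2_ge_0. Qed.

Lemma energy_le_add (a : nat -> C) (n m : nat) :
  energy a n <= energy a (m + n).
Proof.
  induction m as [|m IH]; [apply Rle_refl|].
  simpl. unfold energy in *. simpl.
  pose proof (pow2_ge_0 (Cmod (a (S (m + n))))). simpl in *. lra.
Qed.

Lemma majorant_S_l (a : nat -> C) (r : R) (n : nat) :
  majorant a r (S n) = Cmod (a O) + r * majorant (shift a) r n.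
Proof.
  unfold majorant. rewrite sum_f_R0_S_l, scal_sum. simpl.
  rewrite Rmult_1_r. f_equal. apply sum_eq. intros k _. unfold shift. ring.
Qed.

Lemma majorant_ext (a b : nat -> C) (r : R) (n : nat) :
  (forall k, (k <= n)%nat -> a k = b k) -> majorant a r n = majorant b r n.
Proof.
  intros H. apply sum_eq. intros k Hk. now rewrite H.
Qed.

Lemma majorant_pos (a : nat -> C) (r : R) (n : nat) :
  0 <= r -> 0 <= majorant a r n.
Proof.
  intros Hr. apply cond_pos_sum. intros k.
  apply Rmult_le_pos; [apply Cmod_ge_0|now apply pow_le].
Qed.

Lemma majorant_le_S (a : nat -> C) (r : R) (n : nat) :
  0 <= r -> majorant a r n <= majorant a r (S n).
Proof.
  intros Hr. unfold majorant. rewrite tech5.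
  assert (0 <= Cmod (a (S n)) * r ^ S n); [|lra].
  apply Rmult_le_pos; [apply Cmod_ge_0|now apply pow_le].
Qed.

Lemma majorant_scal (c : C) (a : nat -> C) (r : R) (n : nat) :
  majorant (fun k => c * a k)%C r n = Cmod c * majorant a r n.
Proof.
  unfold majorant. rewrite scal_sum. apply sum_eq. intros k _.
  rewrite Cmod_mult. ring.
Qed.

Lemma majorant_plus (a b : nat -> C) (r : R) (n : nat) :
  0 <= r ->
  majorant (fun k => a k + b k)%C r n <= majorant a r n + majorant b r n.
Proof.
  intros Hr. unfold majorant. rewrite <- plus_sum. apply sum_Rle.
  intros k _. rewrite <- Rmult_plus_distr_r.
  apply Rmult_le_compat_r; [now apply pow_le|apply Cmod_triangle].
Qed.

(** Cutting the product after degree [n] keeps only part of the nonnegative products of terms of the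
    two majorants. *)
Lemma majorant_conv (a b : nat -> C) (r : R) (n : nat) :
  0 <= r -> majorant (conv a b) r n <= majorant a r n * majorant b r n.
Proof.
  intros Hr. revert a; induction n as [|n IH]; intros a.
  - unfold majorant; simpl. rewrite Cmod_mult. lra.
  - assert (H : majorant (shift (conv a b)) r n
       <= Cmod (a O) * majorant (shift b) r n
          + majorant (shift a) r n * majorant b r n).
    { change (shift (conv a b)) with
        (fun k => a O * shift b k + conv (shift a) b k)%C.
      eapply Rle_trans; [now apply majorant_plus|].
      rewrite majorant_scal. specialize (IH (shift a)). lra. }
    rewrite (majorant_S_l (conv a b)), (majorant_S_l a).
    change (conv a b O) with (a O * b O)%C. rewrite Cmod_mult.
    pose proof (majorant_le_S b r n Hr) as Hb.
    pose proof (majorant_pos (shift a) r n Hr) as Ha.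
    rewrite Rmult_plus_distr_r.
    (* Only the copy multiplied by |a_0| is expanded. The other keeps length [S n], which dominates
       the length [n] of the inductive hypothesis. *)
    rewrite (majorant_S_l b) at 1.
    apply Rle_trans with (Cmod (a O) * Cmod (b O)
       + r * (Cmod (a O) * majorant (shift b) r n
              + majorant (shift a) r n * majorant b r (S n))).
    + apply Rplus_le_compat_l, Rmult_le_compat_l; trivial.
      eapply Rle_trans; [apply H|].
      apply Rplus_le_compat_l, Rmult_le_compat_l; trivial.
    + apply Req_le. ring.
Qed.

(** * Coefficients of contractive sequences *)

Lemma Cmod2_plus (z w : C) :
  Cmod (z + w) ^ 2 = Cmod z ^ 2 + Cmod w ^ 2 + 2 * Re (Cconj z * w).
Proof. rewrite !Cmod2_alt. destruct z, w; simpl. ring. Qed.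

Lemma contractive_bound_0 (a : nat -> C) :
  contractive a 0 -> Cmod (a O) <= 1.
Proof.
  intros H. specialize (H (fun _ => RtoC 1)).
  unfold energy in H; simpl in H.
  rewrite Cmult_1_r, Cmod_1 in H.
  pose proof (Cmod_ge_0 (a O)). nra.
Qed.

Lemma conv_single (a : nat -> C) (v : C) (n : nat) :
  conv a (fun k => if Nat.eqb k n then v else 0) n = (a O * v)%C.
Proof.
  induction n as [|n IH]; [reflexivity|].
  rewrite conv_S_r. simpl. unfold shift; simpl. rewrite IH. ring.
Qed.

(* The 2x2 submatrix [[a_0, 0], [a_n, a_0]] of the Toeplitz matrix. *)
Lemma contractive_two_point (a : nat -> C) (n : nat) (w v : C) :
  contractive a (S n) ->
  Cmod (a O * w) ^ 2 + Cmod (a (S n) * w + a O * v) ^ 2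
  <= Cmod w ^ 2 + Cmod v ^ 2.
Proof.
  intros H.
  (* The input lives in positions 0 and [S n]; of the output only these two entries are kept, the
     others adding nonnegative energy. *)
  set (x := fun k => match k with O => w
                     | S j => if Nat.eqb j n then v else RtoC 0 end).
  specialize (H x).
  assert (Hx : energy x (S n) = Cmod w ^ 2 + Cmod v ^ 2).
  { rewrite energy_S_l. f_equal.
    destruct n as [|n]; [reflexivity|].
    unfold energy. rewrite tech5.
    unfold shift, x at 2. rewrite Nat.eqb_refl.
    rewrite <- (Rplus_0_l (Cmod v ^ 2)) at 2. f_equal.
    rewrite <- (sum_eq_R0 (fun _ => 0) n) by reflexivity.
    apply sum_eq. intros k Hk. unfold x.
    destruct (Nat.eqb_spec k (S n)); [lia|]. rewrite Cmod_0. ring. }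
  assert (Hy : Cmod (conv a x O) ^ 2 + Cmod (conv a x (S n)) ^ 2
                 <= energy (conv a x) (S n)).
  { rewrite energy_S_l. apply Rplus_le_compat_l.
    destruct n as [|n]; [apply Rle_refl|].
    unfold energy. rewrite tech5.
    pose proof (energy_pos (shift (conv a x)) n) as Hp.
    unfold energy in Hp. unfold shift at 2. lra. }
  assert (Hc : conv a x (S n) = (a (S n) * w + a O * v)%C).
  { rewrite conv_S_r. change (shift x) with
      (fun k => if Nat.eqb k n then v else RtoC 0).
    rewrite conv_single. unfold x. ring. }
  rewrite Hc, Hx in *. change (conv a x O) with (a O * w)%C in Hy. lra.
Qed.

(** A triangular 2x2 matrix with both diagonal entries a_0 and corner entry c is a contraction
    exactly when |c| <= 1 - |a_0|^2; one well-chosen test vector shows the direction used here. *)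
Lemma contractive_coeff (a : nat -> C) (n : nat) :
  contractive a 0 -> contractive a (S n) ->
  Cmod (a (S n)) <= 1 - Cmod (a O) ^ 2.
Proof.
  intros H0 H. pose proof (contractive_bound_0 a H0) as Hs.
  pose proof (Cmod_ge_0 (a O)) as Hs0.
  pose proof (Cmod_ge_0 (a (S n))) as Hn0.
  set (s := Cmod (a O)) in *.
  destruct (Req_dec s 1) as [E|E].
  (* With |a_0| = 1 the first basis vector already has full norm in its first output entry, which
     forces the corner entry to vanish. *)
  - pose proof (contractive_two_point a n 1 0 H) as Hw.
    rewrite Cmult_1_r, Cmult_1_r, Cmult_0_r, Cplus_0_r, Cmod_1, Cmod_0 in Hw.
    fold s in Hw. rewrite E in *. nra.
  (* This vector makes the second output entry equal to [a (S n)] itself. A factor 1 - s^2 > 0 then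
     cancels from the inequality. *)
  - pose proof (contractive_two_point a n (1 - s ^ 2)%R
                  (Cconj (a O) * a (S n))%C H) as Hw.
    replace (a (S n) * (1 - s ^ 2)%R + a O * (Cconj (a O) * a (S n)))%C
      with (a (S n)) in Hw.
    2:{ rewrite Cmult_assoc, <- Cmod2_conj. fold s.
        rewrite RtoC_minus, RtoC_pow. ring. }
    rewrite !Cmod_mult, Cmod_conj, Cmod_R, Rabs_pos_eq in Hw by nra.
    fold s in Hw.
    set (q := Cmod (a (S n))) in *.
    assert (Hq : (1 - s ^ 2) * q ^ 2 <= (1 - s ^ 2) * (1 - s ^ 2) ^ 2) by nra.
    apply Rmult_le_reg_l in Hq; [|nra].
    apply Rsqr_incr_0_var; unfold Rsqr; nra.
Qed.

(** Writing the input as y = (1 - conj a_0 f) x gives z h y = (f - a_0) x, so the Moebius identity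
    transfers contractivity from f to z h. The factor z costs one degree, hence [S n] for [a] and
    [n] for [h]. *)
Lemma contractive_schwarz_quotient (a h : nat -> C) (n : nat) :
  contractive a (S n) -> Cmod (a O) < 1 ->
  (forall k, (k <= n)%nat ->
     conv h (fun j => (if Nat.eqb j 0 then 1 else 0)
                      + - Cconj (a O) * a j)%C k = a (S k)) ->
  contractive h n.
Proof.
  intros Ha Ht Hh y.
  set (t := Cmod (a O)) in *.
  assert (Ht0 : 0 <= t) by apply Cmod_ge_0.
  set (u := fun j : nat => ((if Nat.eqb j 0 then 1 else 0)
                      + - Cconj (a O) * a j)%C) in *.
  assert (Hu : u O = RtoC (1 - t ^ 2)).
  { unfold u; simpl Nat.eqb. cbv iota.
    rewrite RtoC_minus. unfold t. rewrite Cmod2_conj. ring. }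
  assert (Hu0 : u O <> 0).
  { rewrite Hu. intros E. apply RtoC_inj in E. nra. }
  (* Padding by 0 at index [S n] keeps the energy of the input unchanged when one more degree is
     allowed. *)
  set (y' := fun k => if Nat.leb k n then y k else RtoC 0).
  destruct (conv_solve u y' (S n) Hu0) as [x Hx].
  (* Coefficients of z h. *)
  set (g := fun k => match k with O => RtoC 0 | S j => h j end).
  (* This is z h (1 - conj a_0 f) = f - a_0; the factor 1 is kept so that [conv_affine_l]
     applies. *)
  assert (Hg : forall k, (k <= S n)%nat ->
     conv g u k = ((if Nat.eqb k 0 then - a O else 0) + 1 * a k)%C).
  { intros [|k] Hk.
    - simpl. ring.
    - simpl conv. change (shift g) with h. rewrite Hh by lia. simpl. ring. }
  assert (Hgy : forall k, (k <= S n)%nat ->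
     conv g y' k = (- a O * x k + 1 * conv a x k)%C).
  { intros k Hk.
    rewrite <- conv_affine_l.
    rewrite (conv_ext g g y' (conv u x)), <- conv_assoc.
    - apply conv_ext; trivial. intros j Hj. apply Hg; lia.
    - reflexivity.
    - intros j Hj. symmetry. apply Hx; lia. }
  assert (Hy : forall k, (k <= S n)%nat ->
     y' k = (1 * x k + - Cconj (a O) * conv a x k)%C).
  { intros k Hk. rewrite <- Hx by lia. unfold u. apply conv_affine_l. }
  assert (E1 : energy y' (S n) = energy y n).
  { unfold energy. rewrite tech5. unfold y' at 2.
    replace (Nat.leb (S n) n) with false
      by (symmetry; apply Nat.leb_gt; lia).
    rewrite Cmod_0, pow_i, Rplus_0_r by lia.
    apply energy_ext. intros k Hk. unfold y'.
    apply Nat.leb_le in Hk. now rewrite Hk. }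
  assert (E2 : energy (conv g y') (S n) = energy (conv h y) n).
  { rewrite energy_S_l.
    replace (conv g y' O) with (RtoC 0) by (simpl; ring).
    rewrite Cmod_0, pow_i, Rplus_0_l by lia.
    apply energy_ext. intros k Hk.
    unfold shift at 1. simpl conv. change (shift g) with h.
    rewrite (conv_ext h h y' y); trivial.
    - ring.
    - intros j Hj. unfold y'.
      replace (Nat.leb j n) with true by (symmetry; apply Nat.leb_le; lia).
      reflexivity. }
  (* |w - b|^2 and |1 - b* w|^2 differ by (1-|b|^2)(1-|w|^2), homogenised *)
  assert (E3 : energy y' (S n) - energy (conv g y') (S n)
     = (1 - t ^ 2) * (energy x (S n) - energy (conv a x) (S n))).
  { unfold energy. rewrite <- !minus_sum, scal_sum.
    apply sum_eq. intros k Hk. rewrite Hy, Hgy by lia.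
    unfold t. rewrite !Cmod2_alt.
    destruct (a O), (x k), (conv a x k); simpl; ring. }
  specialize (Ha x). rewrite E1, E2 in E3.
  assert (0 <= (1 - t ^ 2) * (energy x (S n) - energy (conv a x) (S n)))
    by (apply Rmult_le_pos; nra).
  lra.
Qed.

(** * Bohr's inequality and its refinement for finite sums *)

Lemma majorant_contractive_le_1 (h : nat -> C) (r : R) (n : nat) :
  0 <= r <= 1 / 3 ->
  (forall k, (k <= n)%nat -> contractive h k) ->
  majorant h r n <= 1.
Proof.
  intros Hr H.
  pose proof (contractive_bound_0 h (H O ltac:(lia))) as H0.
  pose proof (Cmod_ge_0 (h O)) as Hs.
  set (s := Cmod (h O)) in *.
  (* For r <= 1/3 each power r^(m+1) is at most half of r^m - r^(m+1), so the geometric sum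
     telescopes to (1 - r^m)/2. *)
  assert (Hm : forall m, (m <= n)%nat ->
     majorant h r m <= s + (1 - s ^ 2) * ((1 - r ^ m) / 2)).
  { induction m as [|m IH]; intros Hmn.
    - unfold majorant; simpl. fold s. lra.
    - unfold majorant in *. rewrite tech5.
      specialize (IH ltac:(lia)).
      assert (Hc : Cmod (h (S m)) <= 1 - s ^ 2)
        by (apply contractive_coeff; apply H; lia).
      pose proof (pow_le r m ltac:(lra)) as Hp.
      assert (Hi : Cmod (h (S m)) * r ^ S m <= (1 - s ^ 2) * r ^ S m).
      { apply Rmult_le_compat_r; trivial. apply pow_le; lra. }
      assert (Hj : r ^ S m <= r ^ m / 3) by (simpl; nra).
      assert (0 <= 1 - s ^ 2) by nra.
      assert ((1 - s ^ 2) * (r ^ S m) <=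
              (1 - s ^ 2) * ((r ^ m - r ^ S m) / 2)).
      { apply Rmult_le_compat_l; lra. }
      lra. }
  specialize (Hm n (le_n n)).
  pose proof (pow_le r n ltac:(lra)) as Hp.
  assert (0 <= (1 - s ^ 2) * r ^ n) by (apply Rmult_le_pos; nra).
  (* Here s + (1 - s^2)/2 = 1 - (1 - s)^2/2. *)
  nra.
Qed.

(** With M the majorant of [shift a], the factorisation (f - a_0)/z = h (1 - conj a_0 f) and M h <=
    1 give M <= 1 - |a_0|^2 + |a_0| r M; solving for M is the claim. *)
Lemma majorant_shift_contractive (a : nat -> C) (r : R) (n : nat) :
  0 <= r <= 1 / 3 -> (forall k, contractive a k) ->
  majorant (shift a) r n * (1 - Cmod (a O) * r) <= 1 - Cmod (a O) ^ 2.
Proof.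
  intros Hr Ha.
  pose proof (contractive_bound_0 a (Ha O)) as Ht.
  pose proof (Cmod_ge_0 (a O)) as Ht0.
  set (t := Cmod (a O)) in *.
  destruct (Req_dec t 1) as [E|E].
  (* For |a_0| = 1 the divisor has zero constant term, but then all higher coefficients vanish. *)
  - assert (Hz : majorant (shift a) r n = 0).
    { unfold majorant. rewrite <- (sum_eq_R0 (fun _ => 0) n) by reflexivity.
      apply sum_eq. intros k _.
      pose proof (contractive_coeff a k (Ha O) (Ha (S k))) as Hk.
      fold t in Hk. rewrite E in Hk. pose proof (Cmod_ge_0 (a (S k))).
      unfold shift. replace (Cmod (a (S k))) with 0 by lra. ring. }
    rewrite Hz, E. lra.
  - set (u := fun j : nat => ((if Nat.eqb j 0 then 1 else 0)
                      + - Cconj (a O) * a j)%C).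
    assert (Hu : u O = RtoC (1 - t ^ 2)).
    { unfold u; simpl Nat.eqb. cbv iota.
      rewrite RtoC_minus. unfold t. rewrite Cmod2_conj. ring. }
    assert (Hu0 : u O <> 0).
    { rewrite Hu. intros F. apply RtoC_inj in F. nra. }
    destruct (conv_solve u (shift a) n Hu0) as [h Hh].
    assert (Hh' : forall k, (k <= n)%nat -> conv h u k = a (S k)).
    { intros k Hk. rewrite conv_comm. now apply Hh. }
    assert (Mh : majorant h r n <= 1).
    { apply majorant_contractive_le_1; trivial. intros k Hk.
      apply contractive_schwarz_quotient with a; trivial.
      - fold t; lra.
      - intros j Hj. apply Hh'. lia. }
    (* The constant term of 1 - conj a_0 f is 1 - t^2; its other coefficients are those of -conj a_0
       (f - a_0), whose majorant carries the extra factor r. *)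
    assert (Mu : majorant u r n
              <= (1 - t ^ 2) + t * r * majorant (shift a) r n).
    { pose proof (majorant_pos (shift a) r n ltac:(lra)) as Hp.
      destruct n as [|n].
      - unfold majorant at 1; simpl. rewrite Hu, Cmod_R, Rabs_pos_eq by nra.
        assert (0 <= t * r) by nra. nra.
      - rewrite majorant_S_l, Hu, Cmod_R, Rabs_pos_eq by nra.
        rewrite (majorant_ext (shift u) (fun k => - Cconj (a O) * shift a k)%C).
        + rewrite majorant_scal, Cmod_opp, Cmod_conj. fold t.
          pose proof (majorant_le_S (shift a) r n ltac:(lra)).
          assert (0 <= t * r) by nra. nra.
        + intros k _. unfold shift, u. simpl. ring. }
    assert (Mc : majorant (shift a) r n <= majorant h r n * majorant u r n).
    { rewrite (majorant_ext (shift a) (conv h u)).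
      - apply majorant_conv; lra.
      - intros k Hk. symmetry. now apply Hh'. }
    pose proof (majorant_pos u r n ltac:(lra)).
    pose proof (majorant_pos h r n ltac:(lra)).
    nra.
Qed.

(** * Bounded functions have contractive coefficients *)

(** Horner's scheme, peeling the head just as [conv] does. *)
Fixpoint poly_eval (a : nat -> C) (n : nat) (z : C) : C :=
  match n with
  | O => a O
  | S m => (a O + z * poly_eval (shift a) m z)%C
  end.

Definition trunc (a : nat -> C) (n : nat) : nat -> C :=
  fun k => if Nat.leb k n then a k else 0.

Lemma trunc_le (a : nat -> C) (n k : nat) : (k <= n)%nat -> trunc a n k = a k.
Proof. intros H. unfold trunc. now rewrite (proj2 (Nat.leb_le k n) H). Qed.

Lemma trunc_gt (a : nat -> C) (n k : nat) : (n < k)%nat -> trunc a n k = 0.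
Proof. intros H. unfold trunc. now rewrite (proj2 (Nat.leb_gt k n) H). Qed.

Lemma poly_eval_ext (a b : nat -> C) (n : nat) (z : C) :
  (forall k, (k <= n)%nat -> a k = b k) -> poly_eval a n z = poly_eval b n z.
Proof.
  revert a b; induction n as [|n IH]; intros a b H; simpl.
  - apply H; lia.
  - rewrite H by lia. rewrite (IH (shift a) (shift b)); trivial.
    intros k Hk. apply H; lia.
Qed.

Lemma poly_eval_S_r (a : nat -> C) (n : nat) (z : C) :
  poly_eval a (S n) z = (poly_eval a n z + a (S n) * z ^ S n)%C.
Proof.
  revert a; induction n as [|n IH]; intros a.
  - simpl. unfold shift. ring.
  - change (poly_eval a (S (S n)) z)
      with (a O + z * poly_eval (shift a) (S n) z)%C.
    rewrite IH. simpl. unfold shift. ring.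
Qed.

Lemma poly_eval_scal (c : C) (a : nat -> C) (n : nat) (z : C) :
  poly_eval (fun k => c * a k)%C n z = (c * poly_eval a n z)%C.
Proof.
  induction n as [|n IH]; [reflexivity|].
  rewrite !poly_eval_S_r, IH. ring.
Qed.

Lemma poly_eval_plus (a b : nat -> C) (n : nat) (z : C) :
  poly_eval (fun k => a k + b k)%C n z = (poly_eval a n z + poly_eval b n z)%C.
Proof.
  induction n as [|n IH]; [reflexivity|].
  rewrite !poly_eval_S_r, IH. ring.
Qed.

Lemma poly_eval_pow (c : C) (a : nat -> C) (n : nat) (z : C) :
  poly_eval (fun k => a k * c ^ k)%C n z = poly_eval a n (c * z)%C.
Proof.
  induction n as [|n IH].
  - simpl; ring.
  - rewrite !poly_eval_S_r, IH, Cpow_mult_l. ring.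
Qed.

Lemma poly_eval_tail (a : nat -> C) (n m : nat) (z : C) :
  (forall k, (n < k)%nat -> a k = 0) ->
  poly_eval a (m + n) z = poly_eval a n z.
Proof.
  intros H. induction m as [|m IH]; [reflexivity|].
  simpl Nat.add. rewrite poly_eval_S_r, IH, H by lia. ring.
Qed.

Lemma poly_eval_conv (a b : nat -> C) (m n : nat) (z : C) :
  (forall k, (m < k)%nat -> a k = 0) -> (forall k, (n < k)%nat -> b k = 0) ->
  poly_eval (conv a b) (m + n) z = (poly_eval a m z * poly_eval b n z)%C.
Proof.
  intros Ha Hb. revert a Ha; induction m as [|m IH]; intros a Ha.
  - simpl Nat.add. simpl (poly_eval a 0 z). rewrite <- poly_eval_scal.
    apply poly_eval_ext. intros [|k] _; [reflexivity|].
    simpl. rewrite conv_0_l; [ring|]. intros j. apply Ha; lia.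
  - simpl Nat.add.
    change (poly_eval (conv a b) (S (m + n)) z) with
      (a O * b O
       + z * poly_eval (fun k => a O * shift b k + conv (shift a) b k)
               (m + n) z)%C.
    rewrite poly_eval_plus, poly_eval_scal, IH
      by (intros k Hk; apply Ha; lia).
    (* Since [b] vanishes beyond [n], it may be evaluated up to degree [S (m + n)], which matches
       the length of the shifted sum. *)
    assert (Hbt : poly_eval b n z
      = (b O + z * poly_eval (shift b) (m + n) z)%C)
      by exact (eq_sym (poly_eval_tail b n (S m) z Hb)).
    change (poly_eval a (S m) z) with (a O + z * poly_eval (shift a) m z)%C.
    rewrite Cmult_plus_distr_r. rewrite Hbt at 2. ring.
Qed.

(** * Parseval's identity on the unit circle *)

Definition cis (t : R) : C := (cos t, sin t).

Lemma Cmod_cis (t : R) : Cmod (cis t) = 1.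
Proof.
  unfold Cmod, cis; simpl fst; simpl snd.
  rewrite <- !Rsqr_pow2, Rplus_comm, sin2_cos2. apply sqrt_1.
Qed.

Lemma cis_pow (t : R) (n : nat) : (cis t ^ n)%C = cis (INR n * t).
Proof.
  induction n as [|n IH].
  - simpl. unfold cis. rewrite Rmult_0_l, cos_0, sin_0. reflexivity.
  - rewrite Cpow_S, IH, S_INR.
    replace ((INR n + 1) * t) with (t + INR n * t) by ring.
    unfold cis, Cmult; simpl. rewrite cos_plus, sin_plus.
    f_equal; ring.
Qed.

Lemma is_RInt_monomial (c : C) (n : nat) :
  is_RInt (fun t => Re (c * cis t ^ S n)) 0 (2 * PI) 0.
Proof.
  set (m := INR (S n)).
  assert (Hm : m <> 0) by (apply not_0_INR; lia).
  (* Real part of c e^(imt)/(im), a periodic antiderivative. *)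
  set (F := fun t => (Re c * sin (m * t) + Im c * cos (m * t)) / m).
  replace 0 with (minus (F (2 * PI)) (F 0)) at 2.
  - apply (is_RInt_derive F).
    + intros t _. rewrite cis_pow. fold m. unfold F, cis, Cmult, Re, Im; simpl.
      auto_derive; [trivial|]. field. exact Hm.
    + intros t _. apply continuous_ext with
        (fun t => Re c * cos (m * t) - Im c * sin (m * t)).
      * intros s. rewrite cis_pow. fold m. unfold cis, Cmult, Re, Im; simpl.
        reflexivity.
      * apply (ex_derive_continuous
          (fun t => Re c * cos (m * t) - Im c * sin (m * t))).
        auto_derive. trivial.
  - unfold F. rewrite Rmult_0_r, sin_0, cos_0.
    replace (m * (2 * PI)) with (0 + 2 * INR (S n) * PI) by (unfold m; ring).
    rewrite sin_period, cos_period, sin_0, cos_0.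
    unfold minus, plus, opp; simpl. ring.
Qed.

Lemma is_RInt_poly_no_constant (a : nat -> C) (n k : nat) :
  is_RInt (fun t => Re (cis t ^ S k * poly_eval a n (cis t))) 0 (2 * PI) 0.
Proof.
  revert a k; induction n as [|n IH]; intros a k.
  - apply is_RInt_ext with (fun t => Re (a O * cis t ^ S k)).
    + intros t _. f_equal. simpl. ring.
    + apply is_RInt_monomial.
  - apply is_RInt_ext with (fun t => plus (Re (a O * cis t ^ S k))
       (Re (cis t ^ S (S k) * poly_eval (shift a) n (cis t)))).
    + intros t _. unfold plus; simpl AbelianMonoid.plus.
      change ((Re (a O * cis t ^ S k)
        + Re (cis t ^ S (S k) * poly_eval (shift a) n (cis t)))%R
        = Re (cis t ^ S k * poly_eval a (S n) (cis t))).
      rewrite <- re_plus. f_equal. simpl. ring.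
    + replace 0 with (plus 0 0) at 2 by apply Rplus_0_l.
      apply (is_RInt_plus (V := R_NormedModule)); [apply is_RInt_monomial|apply IH].
Qed.

(** On the circle |a_0 + z Q|^2 = |a_0|^2 + |Q|^2 + 2 Re (conj a_0 z Q), and the cross term has no
    constant coefficient, so it integrates to 0. Induction along Horner's scheme avoids a double
    sum. *)
Lemma parseval (a : nat -> C) (n : nat) :
  is_RInt (fun t => Cmod (poly_eval a n (cis t)) ^ 2) 0 (2 * PI)
    (2 * PI * energy a n).
Proof.
  assert (Hconst : forall c : R,
    is_RInt (fun _ => c) 0 (2 * PI) (2 * PI * c)).
  { intros c. replace (2 * PI * c) with (scal (2 * PI - 0) c).
    - apply (is_RInt_const (V := R_NormedModule)).
    - unfold scal; simpl; unfold mult; simpl. ring. }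
  revert a; induction n as [|n IH]; intros a.
  - apply (Hconst (Cmod (a O) ^ 2)).
  - rewrite energy_S_l.
    apply is_RInt_ext with (fun t => plus (plus (Cmod (a O) ^ 2)
       (Cmod (poly_eval (shift a) n (cis t)) ^ 2))
       (scal 2 (Re (cis t ^ 1 *
          poly_eval (fun k => Cconj (a O) * shift a k)%C n (cis t))))).
    + intros t _.
      change ((Cmod (a O) ^ 2 + Cmod (poly_eval (shift a) n (cis t)) ^ 2
       + 2 * Re (cis t ^ 1 *
          poly_eval (fun k => Cconj (a O) * shift a k)%C n (cis t)))%R
       = Cmod (a O + cis t * poly_eval (shift a) n (cis t))%C ^ 2).
      rewrite Cmod2_plus, Cmod_mult, Cmod_cis, Rmult_1_l.
      f_equal. f_equal. f_equal. rewrite poly_eval_scal. ring.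
    + replace (2 * PI * (Cmod (a O) ^ 2 + energy (shift a) n)) with
        (plus (plus (2 * PI * Cmod (a O) ^ 2) (2 * PI * energy (shift a) n))
           (scal 2 0)).
      * apply (is_RInt_plus (V := R_NormedModule)).
        -- apply (is_RInt_plus (V := R_NormedModule)); [apply Hconst|apply IH].
        -- apply (is_RInt_scal (V := R_NormedModule)).
           apply is_RInt_poly_no_constant.
      * unfold plus, scal; simpl; unfold mult; simpl. ring.
Qed.

(** * From bounds on partial sums to contractivity *)

Lemma le_at_0_of_le_right (g : R -> R) (A : R) :
  continuity_pt g 0 -> (forall e, 0 < e <= 1 -> A <= g e) -> A <= g 0.
Proof.
  intros Hg H. destruct (Rle_or_lt A (g 0)) as [|Hlt]; trivial.
  destruct (Hg (A - g 0)) as [d [Hd Hc]]; [lra|].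
  set (e := Rmin (d / 2) 1).
  assert (He : 0 < e <= 1 /\ e < d).
  { unfold e, Rmin. destruct (Rle_dec (d / 2) 1); lra. }
  specialize (H e (proj1 He)).
  specialize (Hc e). simpl in Hc. unfold Rdist in Hc.
  assert (Rabs (g e - g 0) < A - g 0).
  { apply Hc. repeat split; [lra|].
    rewrite Rminus_0_r, Rabs_pos_eq; lra. }
  apply Rabs_def2 in H0. lra.
Qed.

(** Multiplying the polynomial of [x] by a partial sum bounded by 1 + e on the circle raises the
    Hardy norm by at most that factor, by Parseval; then e tends to 0. *)
Lemma contractive_of_bounded_on_circle (a : nat -> C) :
  (forall e, 0 < e -> exists M0, forall M, (M0 <= M)%nat ->
     forall z, Cmod z = 1 -> Cmod (poly_eval a M z) <= 1 + e) ->
  forall n, contractive a n.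
Proof.
  intros H n x.
  assert (Hx : energy (trunc x n) n = energy x n).
  { apply energy_ext. intros k Hk. now apply trunc_le. }
  replace (energy x n) with ((1 + 0) ^ 2 * energy x n) by ring.
  apply (le_at_0_of_le_right (fun e => (1 + e) ^ 2 * energy x n)); [reg|].
  intros e He. destruct (H e (proj1 He)) as [M0 HM0].
  (* [M >= n] ensures that truncation leaves the product unchanged up to degree [n]. *)
  set (M := max M0 n).
  specialize (HM0 M (Nat.le_max_l _ _)).
  pose proof (Nat.le_max_r M0 n) as HMn. fold M in HMn.
  set (q := conv (trunc a M) (trunc x n)).
  assert (Hq : energy (conv a x) n <= energy q (M + n)).
  { rewrite (energy_ext (conv a x) q); [apply energy_le_add|].
    intros k Hk. apply conv_ext; intros j Hj; symmetry; apply trunc_le; lia. }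
  assert (Hi : 2 * PI * energy q (M + n)
               <= scal ((1 + e) ^ 2) (2 * PI * energy (trunc x n) n)).
  { pose proof PI_RGT_0.
    eapply is_RInt_le;
      [|apply parseval
       |apply (is_RInt_scal (V := R_NormedModule)); apply parseval|].
    - lra.
    - intros t _. unfold q.
      rewrite poly_eval_conv by (intros; now apply trunc_gt).
      rewrite Cmod_mult, Rpow_mult_distr.
      apply Rmult_le_compat_r; [apply pow2_ge_0|].
      apply pow_incr; split; [apply Cmod_ge_0|].
      rewrite (poly_eval_ext _ a) by (intros; now apply trunc_le).
      apply HM0, Cmod_cis. }
  rewrite Hx in Hi. unfold scal in Hi; simpl in Hi; unfold mult in Hi; simpl in Hi.
  apply Rle_trans with (1 := Hq).
  apply Rmult_le_reg_l with (2 * PI); [pose proof PI_RGT_0; lra|].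
  simpl. lra.
Qed.

(** * Convergence of the power series inside the disc *)

Lemma sum_n_poly_eval (a : nat -> C) (z : C) (n : nat) :
  @sum_n C_AbelianMonoid
    (fun k => @scal C_AbsRing C_ModuleSpace (@pow_n C_Ring z k) (a k)) n
  = poly_eval a n z.
Proof.
  assert (Hp : forall k, @pow_n C_Ring z k = (z ^ k)%C).
  { induction k as [|k IHk]; [reflexivity|]. simpl. now rewrite IHk. }
  induction n as [|n IH].
  - rewrite sum_O. simpl. apply Cmult_1_l.
  - rewrite sum_Sn, IH, poly_eval_S_r, Hp.
    change (poly_eval a n z + z ^ S n * a (S n)
            = poly_eval a n z + a (S n) * z ^ S n)%C. ring.
Qed.

Lemma poly_eval_lim (f : C -> C) (a : nat -> C) (z : C) :
  analytic_in_disc_with_coeffs f a -> in_disc z ->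
  filterlim (fun n => poly_eval a n z) eventually
    (@locally C_NormedModule (f z)).
Proof.
  intros Hf Hz. specialize (Hf z Hz).
  apply filterlim_ext with (2 := Hf). intros n. apply sum_n_poly_eval.
Qed.

Lemma Cmod_poly_eval_lim (f : C -> C) (a : nat -> C) (z : C) :
  analytic_in_disc_with_coeffs f a -> in_disc z ->
  is_lim_seq (fun n => Cmod (poly_eval a n z)) (Cmod (f z)).
Proof.
  intros Hf Hz.
  exact (filterlim_comp _ _ _ _ _ _ _ _ (poly_eval_lim f a z Hf Hz)
           (filterlim_norm (V := C_NormedModule) (f z))).
Qed.

(** Convergence at the real point [s] bounds the partial sums, and each later term is a difference
    of two of them. *)
Lemma coeff_growth (f : C -> C) (a : nat -> C) (s : R) :
  analytic_in_disc_with_coeffs f a -> 0 <= s < 1 ->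
  exists K, forall n, Cmod (a n) * s ^ n <= K.
Proof.
  intros Hf Hs.
  assert (Hd : in_disc s) by (unfold in_disc; rewrite Cmod_R, Rabs_pos_eq; lra).
  destruct (filterlim_bounded (V := C_NormedModule)
    (fun n => poly_eval a n s)) as [K HK].
  { exists (f s). now apply poly_eval_lim. }
  assert (HK' : forall n, Cmod (poly_eval a n s) <= K).
  { exact HK. }
  exists (K + K).
  assert (Hm : forall n, Cmod (a n) * s ^ n = Cmod (a n * RtoC s ^ n)%C).
  { intros n. rewrite Cmod_mult, Cmod_pow, Cmod_R, Rabs_pos_eq; lra. }
  intros [|n].
  - pose proof (HK' O) as H0. simpl in *. pose proof (Cmod_ge_0 (a O)). lra.
  - rewrite Hm.
    replace (a (S n) * RtoC s ^ S n)%C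
      with (poly_eval a (S n) s + - poly_eval a n s)%C
      by (rewrite poly_eval_S_r; ring).
    eapply Rle_trans; [apply Cmod_triangle|]. rewrite Cmod_opp.
    apply Rplus_le_compat; apply HK'.
Qed.

(** The partial sums differ from f, which is bounded by 1, by a tail that is geometrically small
    uniformly on the circle: comparison at a radius [s] between [rho] and 1 gives the ratio q =
    rho/s. *)
Lemma partial_sums_uniform_bound (f : C -> C) (a : nat -> C) (rho e : R) :
  analytic_in_disc_with_coeffs f a -> bounded_by_one_in_disc f ->
  0 < rho < 1 -> 0 < e ->
  exists M0, forall M, (M0 <= M)%nat ->
    forall z, Cmod z = rho -> Cmod (poly_eval a M z) <= 1 + e.
Proof.
  intros Hf Hb Hr He.
  set (s := (1 + rho) / 2). assert (Hs : rho < s < 1) by (unfold s; lra).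
  destruct (coeff_growth f a s Hf) as [K HK]; [lra|].
  assert (HK0 : 0 <= K).
  { eapply Rle_trans; [|apply (HK O)]. simpl.
    pose proof (Cmod_ge_0 (a O)). lra. }
  set (q := rho / s).
  assert (Hqs : q * s = rho) by (unfold q; field; lra).
  assert (Hq : 0 < q < 1) by (split; nra).
  assert (Hterm : forall z n, Cmod z = rho ->
     Cmod (a n * z ^ n)%C <= K * q ^ n).
  { intros z n Hz. rewrite Cmod_mult, Cmod_pow, Hz, <- Hqs, Rpow_mult_distr.
    pose proof (pow_le q n ltac:(lra)). specialize (HK n). nra. }
  set (L := K / (1 - q)).
  assert (HL : L * (1 - q) = K) by (unfold L; field; lra).
  clearbody L. assert (HL0 : 0 <= L) by nra.
  (* The tail is bounded by a difference of powers so that the induction on [j] telescopes. *)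
  assert (Htail : forall z M j, Cmod z = rho ->
     Cmod (poly_eval a M z)
     <= Cmod (poly_eval a (j + M) z) + L * (q ^ M - q ^ (j + M))).
  { intros z M j Hz. induction j as [|j IH].
    - simpl. lra.
    - simpl Nat.add. eapply Rle_trans; [exact IH|].
      replace (poly_eval a (j + M) z)
        with (poly_eval a (S (j + M)) z + - (a (S (j + M)) * z ^ S (j + M)))%C
        by (rewrite poly_eval_S_r; ring).
      pose proof (Cmod_triangle (poly_eval a (S (j + M)) z)
        (- (a (S (j + M)) * z ^ S (j + M)))%C) as Ht.
      rewrite Cmod_opp in Ht.
      pose proof (Hterm z (S (j + M)) Hz) as Hu.
      pose proof (pow_le q (j + M) ltac:(lra)) as Hp.
      assert (K * q ^ S (j + M) <= L * (q ^ (j + M) - q ^ S (j + M))).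
      { rewrite <- HL. simpl pow.
        assert (0 <= L * (1 - q) * q ^ (j + M) * (1 - q)) by
          (repeat apply Rmult_le_pos; lra).
        nra. }
      lra. }
  (* [L + 1] rather than [L], which may be 0. *)
  destruct (pow_lt_1_zero q) with (y := e / (L + 1)) as [M0 HM0].
  { rewrite Rabs_pos_eq; lra. }
  { apply Rdiv_lt_0_compat; lra. }
  exists M0. intros M HM z Hz.
  (* Let [j] tend to infinity in the tail estimate. *)
  assert (Hlim : Rbar_le (Cmod (poly_eval a M z)) (Cmod (f z) + L * q ^ M)).
  { apply is_lim_seq_le with
      (u := fun _ => Cmod (poly_eval a M z))
      (v := fun j => Cmod (poly_eval a (j + M) z) + L * q ^ M).
    - intros j. pose proof (Htail z M j Hz).
      pose proof (pow_le q (j + M) ltac:(lra)). nra.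
    - apply is_lim_seq_const.
    - apply is_lim_seq_plus'; [|apply is_lim_seq_const].
      apply (is_lim_seq_incr_n (fun j => Cmod (poly_eval a j z)) M).
      apply Cmod_poly_eval_lim; trivial. unfold in_disc. lra. }
  simpl in Hlim.
  assert (Hfz : Cmod (f z) <= 1) by (apply Hb; unfold in_disc; lra).
  specialize (HM0 M HM).
  pose proof (pow_le q M ltac:(lra)) as Hp.
  rewrite Rabs_pos_eq in HM0 by trivial.
  assert (q ^ M * (L + 1) < e).
  { apply Rmult_lt_reg_r with (/ (L + 1)); [apply Rinv_0_lt_compat; lra|].
    rewrite Rmult_assoc, Rinv_r, Rmult_1_r by lra. exact HM0. }
  nra.
Qed.

(** The dilate f(rho z) satisfies the bound on the unit circle, so its coefficients are contractive.
    Undoing the dilation up to degree [n] costs at most rho^(-2n), which tends to 1 as rho does. *)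
Lemma bounded_coeffs_contractive (f : C -> C) (a : nat -> C) (n : nat) :
  analytic_in_disc_with_coeffs f a -> bounded_by_one_in_disc f ->
  contractive a n.
Proof.
  intros Hf Hb x.
  replace (energy x n) with ((1 + 0) ^ (2 * n) * energy x n)
    by (rewrite Rplus_0_r, pow1; ring).
  apply (le_at_0_of_le_right (fun d => (1 + d) ^ (2 * n) * energy x n)); [reg|].
  intros d Hd. set (p := 1 + d). set (rho := / p).
  assert (Hp : rho * p = 1) by (unfold rho; apply Rinv_l; unfold p; lra).
  assert (Hr : 0 < rho < 1) by (unfold p in Hp; split; nra).
  assert (Hc : contractive (fun k => a k * RtoC rho ^ k)%C n).
  { apply contractive_of_bounded_on_circle. intros e He.
    destruct (partial_sums_uniform_bound f a rho e Hf Hb Hr He) as [M0 HM0].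
    exists M0. intros M HM z Hz. rewrite poly_eval_pow.
    apply HM0; trivial. rewrite Cmod_mult, Hz, Cmod_R, Rabs_pos_eq; lra. }
  (* Dilating the input as well makes the product the dilate of [conv a x]. *)
  specialize (Hc (fun k => x k * RtoC rho ^ k)%C).
  assert (Hpk : forall k, Cmod (RtoC rho ^ k)%C = rho ^ k).
  { intros k. rewrite Cmod_pow, Cmod_R, Rabs_pos_eq; lra. }
  assert (H1 : energy (fun k => x k * RtoC rho ^ k)%C n <= energy x n).
  { apply sum_Rle. intros k _. rewrite Cmod_mult, Hpk, Rpow_mult_distr.
    rewrite <- pow_mult.
    assert (rho ^ (k * 2) <= 1) by
      (rewrite <- (pow1 (k * 2)); apply pow_incr; lra).
    pose proof (pow2_ge_0 (Cmod (x k))). nra. }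
  assert (H2 : energy (conv a x) n
     <= p ^ (2 * n) * energy (conv (fun k => a k * RtoC rho ^ k)%C
                                   (fun k => x k * RtoC rho ^ k)%C) n).
  { unfold energy at 2. rewrite scal_sum. apply sum_Rle. intros k Hk.
    rewrite conv_pow, Cmod_mult, Hpk, Rpow_mult_distr, Rmult_assoc.
    rewrite <- (Rmult_1_r (Cmod (conv a x k) ^ 2)) at 1.
    apply Rmult_le_compat_l; [apply pow2_ge_0|].
    replace (2 * n)%nat with (k * 2 + 2 * (n - k))%nat by lia.
    rewrite <- pow_mult, pow_add, <- Rmult_assoc, <- Rpow_mult_distr, Hp.
    rewrite pow1, Rmult_1_l. apply pow_R1_Rle. unfold p; lra. }
  eapply Rle_trans; [exact H2|].
  apply Rmult_le_compat_l; [apply pow_le; unfold p; lra|lra].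
Qed.

(** * The refined Bohr inequality and its extremal functions *)

Lemma refined_bohr_le_1 (a : nat -> C) (r : R) :
  (forall n, contractive a n) -> 0 <= r <= 1 / 3 ->
  ex_series (majorant_tail a r) /\ refined_bohr_sum a r <= 1.
Proof.
  intros Ha Hr.
  pose proof (contractive_bound_0 a (Ha O)) as Ht.
  pose proof (Cmod_ge_0 (a O)) as Ht0.
  set (t := Cmod (a O)) in *.
  assert (Hden : 0 < 1 - t * r) by nra.
  (* [B] is exactly the complement to 1 of the first term of [refined_bohr_sum]. *)
  set (B := r * ((1 - t ^ 2) / (1 - t * r))).
  assert (Hsum : forall n, sum_n (majorant_tail a r) n <= B).
  { intros n. rewrite sum_n_Reals.
    replace (sum_f_R0 (majorant_tail a r) n) with (r * majorant (shift a) r n).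
    - apply Rmult_le_compat_l; [lra|]. apply Rle_div_r; trivial.
      now apply majorant_shift_contractive.
    - unfold majorant. rewrite scal_sum. apply sum_eq. intros k _.
      unfold majorant_tail, shift. simpl. ring. }
  assert (Hex : ex_series (majorant_tail a r)).
  { destruct (ex_finite_lim_seq_incr (sum_n (majorant_tail a r)) B) as [l Hl];
      trivial.
    - intros n. rewrite sum_Sn. unfold majorant_tail at 3.
      assert (0 <= Cmod (a (S (S n))) * r ^ S (S n)).
      { apply Rmult_le_pos; [apply Cmod_ge_0|apply pow_le; lra]. }
      unfold Hierarchy.plus; simpl in *. lra.
    - exists l. exact Hl. }
  split; trivial.
  assert (HS : Series (majorant_tail a r) <= B).
  { apply Series_correct in Hex.
    exact (is_lim_seq_le _ _ (Series (majorant_tail a r)) B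
             Hsum Hex (is_lim_seq_const B)). }
  unfold refined_bohr_sum. fold t.
  replace 1 with ((1 - (1 + t - t ^ 2) * r) / (1 - t * r) + B) at 4
    by (unfold B; field; lra).
  lra.
Qed.

(** * The extremal Moebius functions *)

Lemma mobius_denominator_neq_0 (b z : C) :
  in_disc b -> in_disc z -> (1 + Cconj b * z)%C <> 0.
Proof.
  unfold in_disc. intros Hb Hz E.
  assert (H : Cmod (Cconj b * z)%C = 1).
  { replace (Cconj b * z)%C with (- (1) + (1 + Cconj b * z))%C by ring.
    rewrite E, Cplus_0_r. apply Cmod_m1. }
  rewrite Cmod_mult, Cmod_conj in H.
  pose proof (Cmod_ge_0 b). pose proof (Cmod_ge_0 z). nra.
Qed.

Lemma mobius_bounded (b : C) : in_disc b -> bounded_by_one_in_disc (mobius b).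
Proof.
  intros Hb z Hz. unfold mobius.
  pose proof (mobius_denominator_neq_0 b z Hb Hz) as Hd.
  rewrite Cmod_div by trivial.
  apply Cmod_gt_0 in Hd.
  apply Rle_div_l; trivial. rewrite Rmult_1_l.
  apply Rsqr_incr_0_var; [|lra]. rewrite !Rsqr_pow2.
  unfold in_disc in *.
  assert (E : Cmod (1 + Cconj b * z)%C ^ 2 - Cmod (z + b)%C ^ 2
            = (1 - Cmod b ^ 2) * (1 - Cmod z ^ 2)).
  { rewrite !Cmod2_alt. destruct b, z; simpl. ring. }
  pose proof (Cmod_ge_0 b). pose proof (Cmod_ge_0 z).
  assert (0 <= (1 - Cmod b ^ 2) * (1 - Cmod z ^ 2))
    by (apply Rmult_le_pos; nra).
  lra.
Qed.

(** Geometric expansion of b + (1 - |b|^2) z / (1 + conj b z), which is the Moebius map. *)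
Definition mobius_coeff (b : C) (n : nat) : C :=
  match n with
  | O => b
  | S m => ((1 - Cmod b ^ 2)%R * (- Cconj b) ^ m)%C
  end.

(** Finite geometric sum with its explicit remainder, which tends to 0 because |b z| < 1. *)
Lemma mobius_partial_sum (b z : C) (n : nat) :
  in_disc b -> in_disc z ->
  poly_eval (mobius_coeff b) n z
  = (mobius b z - (1 - Cmod b ^ 2)%R * z / (1 + Cconj b * z)
                  * (- Cconj b * z) ^ n)%C.
Proof.
  intros Hb Hz. pose proof (mobius_denominator_neq_0 b z Hb Hz) as Hd.
  unfold mobius. induction n as [|n IH].
  - change ((- Cconj b * z) ^ 0)%C with (RtoC 1). simpl poly_eval.
    rewrite RtoC_minus, Cmod2_conj. field. exact Hd.
  - rewrite poly_eval_S_r, IH. 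
    change (mobius_coeff b (S n))
      with ((1 - Cmod b ^ 2)%R * (- Cconj b) ^ n)%C.
    rewrite !Cpow_S, Cpow_mult_l.
    generalize (z ^ n)%C ((- Cconj b) ^ n)%C. intros x y.
    field. exact Hd.
Qed.

Lemma mobius_analytic (b : C) :
  in_disc b -> analytic_in_disc_with_coeffs (mobius b) (mobius_coeff b).
Proof.
  intros Hb z Hz.
  apply filterlim_ext with (fun n => poly_eval (mobius_coeff b) n z).
  { intros n. symmetry. apply sum_n_poly_eval. }
  apply (filterlim_locally_ball_norm (U := C_NormedModule)). intros eps.
  set (D := Cmod ((1 - Cmod b ^ 2)%R * z / (1 + Cconj b * z))%C).
  assert (HD : 0 <= D) by apply Cmod_ge_0.
  set (q := Cmod b * Cmod z).
  assert (Hq : 0 <= q < 1).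
  { unfold q, in_disc in *.
    pose proof (Cmod_ge_0 b). pose proof (Cmod_ge_0 z). split; nra. }
  destruct (pow_lt_1_zero q) with (y := eps / (D + 1)) as [N HN].
  { rewrite Rabs_pos_eq; lra. }
  { apply Rdiv_lt_0_compat; [apply cond_pos|lra]. }
  exists N. intros n Hn. specialize (HN n Hn).
  rewrite Rabs_pos_eq in HN by (apply pow_le; lra).
  rewrite mobius_partial_sum by trivial.
  unfold ball_norm.
  match goal with |- norm (minus (?u - ?v)%C ?u) < _ =>
    change (Cmod ((u - v) - u)%C < eps);
    replace ((u - v) - u)%C with (- v)%C by ring end.
  rewrite Cmod_opp, Cmod_mult, Cmod_pow, Cmod_mult, Cmod_opp, Cmod_conj.
  fold D q.
  assert (q ^ n * (D + 1) < eps) by now apply Rlt_div_r; [lra|].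
  pose proof (pow_le q n ltac:(lra)). nra.
Qed.

(** The moduli of the coefficients again form a geometric series, whose sum (1 - |b|^2) r / (1 - |b|
    r) attains the bound [B] of [refined_bohr_le_1]. *)
Lemma mobius_refined_bohr_eq_1 (b : C) (r : R) :
  in_disc b -> 0 <= r <= 1 / 3 ->
  ex_series (majorant_tail (mobius_coeff b) r) /\
  refined_bohr_sum (mobius_coeff b) r = 1.
Proof.
  unfold in_disc. intros Hb Hr. pose proof (Cmod_ge_0 b) as Hb0.
  assert (Htr : 0 <= Cmod b * r < 1) by nra.
  assert (Hs : is_series (majorant_tail (mobius_coeff b) r)
                 ((1 - Cmod b ^ 2) * r * / (1 - Cmod b * r))).
  { apply is_series_ext with
      (fun n => scal ((1 - Cmod b ^ 2) * r) ((Cmod b * r) ^ n)).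
    - intros n. unfold majorant_tail. simpl mobius_coeff.
      rewrite Cmod_mult, Cmod_pow, Cmod_opp, Cmod_conj, Cmod_R, Rabs_pos_eq
        by nra.
      rewrite Rpow_mult_distr. unfold scal; simpl; unfold mult; simpl. ring.
    - apply (is_series_scal (V := R_NormedModule)), is_series_geom.
      rewrite Rabs_pos_eq; lra. }
  split.
  - eexists; exact Hs.
  - unfold refined_bohr_sum. rewrite (is_series_unique _ _ Hs).
    simpl mobius_coeff. field. lra.
Qed.

Theorem corollary2p6 :
  (forall (f : C -> C) (a : nat -> C),
      analytic_in_disc_with_coeffs f a ->
      bounded_by_one_in_disc f ->
      forall r : R, 0 <= r <= 1 / 3 ->
        ex_series (majorant_tail a r) /\ refined_bohr_sum a r <= 1)
  /\
  (forall a0 : C, in_disc a0 ->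
      bounded_by_one_in_disc (mobius a0) /\
      exists a : nat -> C,
        analytic_in_disc_with_coeffs (mobius a0) a /\
        a O = a0 /\
        forall r : R, 0 <= r <= 1 / 3 ->
          ex_series (majorant_tail a r) /\ refined_bohr_sum a r = 1).
Proof.
  split.
  - intros f a Hf Hb r Hr. apply refined_bohr_le_1; trivial.
    intros n. now apply bounded_coeffs_contractive with f.
  - intros a0 Ha0. split; [now apply mobius_bounded|].
    exists (mobius_coeff a0). split; [now apply mobius_analytic|].
    split; [reflexivity|].
    intros r Hr. now apply mobius_refined_bohr_eq_1.
Qed.
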